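(* Let $p\ge 3$ and $n$ be integers with $n\ge (p^2-p-2)/2$. Then the fan $F_n$ is $p$-good, i.e. $r(K_p,F_n)=2(p-1)n+1$.
   Context: For graphs $G_1,G_2$, the Ramsey number $r(G_1,G_2)$ is the smallest positive integer $N$ such that for every graph $G$ on $N$ vertices, either $G$ contains $G_1$ as a subgraph or the complement $\overline{G}$ contains $G_2$ as a subgraph. $K_p$ is the complete graph on $p$ vertices. A connected graph $F$ is $p$-good if $r(K_p,F)=(p-1)(|V(F)|-1)+1$. The fan $F_n=K_1+nK_2$ is the graph consisting of $n$ disjoint edges together with one additional vertex adjacent to all $2n$ endpoints of these edges. *)

(* Defs.v *)
From HB Require Import structures.
From mathcomp Require Import all_boot.

Set Implicit Arguments.
Unset Strict Implicit.
Unset Printing Implicit Defensive.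

Record sgraph := SGraph {
  vertex :> finType;
  adj : rel vertex;
  adj_sym : symmetric adj;
  adj_irrefl : irreflexive adj
}.

Definition compl_adj (G : sgraph) : rel G :=
  fun x y => (x != y) && ~~ adj x y.

Lemma compl_adj_sym (G : sgraph) : symmetric (@compl_adj G).
Proof. by move=> x y; rewrite /compl_adj eq_sym adj_sym. Qed.

Lemma compl_adj_irrefl (G : sgraph) : irreflexive (@compl_adj G).
Proof. by move=> x; rewrite /compl_adj eqxx. Qed.

Definition compl (G : sgraph) : sgraph :=
  SGraph (@compl_adj_sym G) (@compl_adj_irrefl G).

(* Subgraph containment up to isomorphism; not necessarily induced. *)
Definition contains (G H : sgraph) : Prop :=
  exists2 f : H -> G, injective f & forall x y, adj x y -> adj (f x) (f y).

Definition connected (G : sgraph) : Prop :=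
  0 < #|G| /\ forall x y : G, connect (@adj G) x y.

Definition complete_adj (p : nat) : rel 'I_p := fun x y => x != y.

Lemma complete_adj_sym p : symmetric (@complete_adj p).
Proof. by move=> x y; rewrite /complete_adj eq_sym. Qed.

Lemma complete_adj_irrefl p : irreflexive (@complete_adj p).
Proof. by move=> x; rewrite /complete_adj eqxx. Qed.

Definition complete (p : nat) : sgraph :=
  SGraph (@complete_adj_sym p) (@complete_adj_irrefl p).

(* [None] is the additional vertex; the i-th of the n disjoint edges joins
   [Some (i, false)] to [Some (i, true)]. *)
Definition fan_adj (n : nat) : rel (option ('I_n * bool)) :=
  fun x y =>
    match x, y with
    | None, None => false
    | None, Some _ | Some _, None => true
    | Some (i, a), Some (j, b) => (i == j) && (a != b)
    end.

Lemma fan_adj_sym n : symmetric (@fan_adj n).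
Proof.
by move=> [[i a]|] [[j b]|] //=; rewrite [i == j]eq_sym [a == b]eq_sym.
Qed.

Lemma fan_adj_irrefl n : irreflexive (@fan_adj n).
Proof. by move=> [[i a]|] //=; rewrite !eqxx. Qed.

Definition fan (n : nat) : sgraph :=
  SGraph (@fan_adj_sym n) (@fan_adj_irrefl n).

Definition arrows (N : nat) (G1 G2 : sgraph) : Prop :=
  forall G : sgraph, #|G| = N -> contains G G1 \/ contains (compl G) G2.

(* "r(G1, G2) = N", as a relation. *)
Definition is_ramsey_number (G1 G2 : sgraph) (N : nat) : Prop :=
  [/\ 0 < N, arrows N G1 G2
    & forall M, 0 < M -> arrows M G1 G2 -> N <= M].

Definition p_good (p : nat) (F : sgraph) : Prop :=
  connected F /\
  is_ramsey_number (complete p) F ((p - 1) * (#|F| - 1) + 1).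

(* Main.v *)
(** Write k = p - 1 and let H be the complement of a K_p-free graph on more
    than 2kn vertices, with no F_n in H; so H has no stable set of size k + 1.
    A greedy matching bounds all degrees of H by 2n + k - 2.  By induction on p
    there is a stable set u_1, ..., u_k, and two non-adjacent vertices have at
    most 2k - 3 common neighbours, since otherwise a stable set of size k - 1
    survives outside their neighbourhoods.  Stable k-sets dominate H, so by the
    degree bound the total multiple coverage by any of them is less than
    k^2 - k.  In particular the private neighbourhoods P_i of the u_i are
    cliques, of size at most 2n, missing few vertices, and some vertex x has at
    most 2k - 3 neighbours in each P_i.

    Among the stable transversals (y_i) of the P_i avoiding the neighbours of x
    in the two smallest P_i, take one with the fewest neighbours of x.  If
    y_j is adjacent to x, no exchange of y_j, or of y_j and one further y_i,
    lowers this number; hence nearly every vertex of P_j is covered three times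
    by (y_i), which exceeds the bound on the multiple coverage.  So no y_j is
    adjacent to x, and x extends the transversal to a stable set of size k + 1.

    The lower bound is the complete (p - 1)-partite graph with parts of
    size 2n. *)

Require Import Defs.
From HB Require Import structures.
From mathcomp Require Import all_boot.
From mathcomp Require Import zify.

Set Implicit Arguments.
Unset Strict Implicit.
Unset Printing Implicit Defensive.

(** * Stable sets, greedy matchings and fans *)

Section Independence.

Variables (T : finType) (e : rel T).
Hypotheses (e_sym : symmetric e) (e_irr : irreflexive e).

Definition stable (S : {set T}) : bool :=
  [forall x in S, forall y in S, ~~ e x y].

Lemma stableP (S : {set T}) :
  reflect {in S &, forall x y, ~~ e x y} (stable S).
Proof.
apply: (iffP forall_inP) => [H x y xS yS | H x xS].
  by have /forall_inP := H x xS; apply.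
by apply/forall_inP => y yS; apply: H.
Qed.

Lemma stable_set0 : stable set0.
Proof. by apply/stableP => x y; rewrite inE. Qed.

Lemma stable_set1 x : stable [set x].
Proof. by apply/stableP => y z /set1P-> /set1P->; rewrite e_irr. Qed.

Lemma stable_setU1 x (S : {set T}) :
  stable S -> {in S, forall y, ~~ e x y} -> stable (x |: S).
Proof.
move=> /stableP stS xS; apply/stableP => y z.
case/setU1P => [->|yS] /setU1P[->|zS]; first by rewrite e_irr.
- exact: xS.
- by rewrite e_sym; apply: xS.
- exact: stS.
Qed.

(* Any q vertices of B span an edge, so edges can be taken out of B one at a
   time as long as q vertices remain. *)
Lemma greedy_matching (x0 : T) q m (B : {set T}) :
  (forall S : {set T}, S \subset B -> stable S -> #|S| < q) ->
  m.*2 + q <= #|B| + 2 ->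
  exists s : seq T, [/\ size s = m.*2, uniq s, {subset s <= B} &
    forall i, i < m -> e (nth x0 s i.*2) (nth x0 s i.*2.+1)].
Proof.
elim: m B => [|m IHm] B Bq leB; first by exists [::].
have /forall_inPn[x xB /forall_inPn[y yB /negPn exy]] : ~~ stable B.
  by apply/negP => /(Bq B (subxx _)); rewrite doubleS in leB; lia.
have nxy : x != y by apply: contraTneq exy => ->; rewrite e_irr.
have [||s [sz us sB es]] := IHm (B :\ x :\ y).
- move=> S SB; apply: Bq; apply: subset_trans SB _.
  by rewrite !subDset; apply/subsetP => z zB; rewrite !inE zB !orbT.
- have := cardsD1 x B; have := cardsD1 y (B :\ x).
  by rewrite !inE xB yB eq_sym nxy /=; rewrite doubleS in leB; lia.
exists [:: x, y & s]; split=> /=.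
- by rewrite sz doubleS.
- have xs : x \notin s by apply/negP => /sB; rewrite !inE eqxx /= andbF.
  have ys : y \notin s by apply/negP => /sB; rewrite !inE eqxx.
  by rewrite inE negb_or nxy xs ys us.
- by move=> z; rewrite !inE => /or3P[/eqP->|/eqP->|/sB] //; rewrite !inE => /and3P[].
- by case=> [|i] //= lti; apply: es.
Qed.

Variable n : nat.

(** A fan is coded by its centre [v] and the list of its 2n leaves, entries 2i and 2i + 1 forming
    the i-th edge; the default [v] is never reached. *)
Definition fan_free : Prop := forall v (s : seq T),
  size s = n.*2 -> uniq s -> all (e v) s ->
  ~ (forall i, i < n -> e (nth v s i.*2) (nth v s i.*2.+1)).

Hypothesis nofan : fan_free.

(** A matching of n edges among the neighbours of [v] is a fan with centre [v], so the neighbourhood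
    is too small for [greedy_matching]. *)
Lemma fan_free_degree q (A : {set T}) v :
  (forall S : {set T}, S \subset A -> stable S -> #|S| < q) ->
  #|[set w in A | e v w]| + 2 < n.*2 + q.
Proof.
move=> Aq; rewrite ltnNge; apply/negP => leB.
have [|s [sz us sB es]] := greedy_matching v _ leB.
  move=> S SB; apply: Aq; apply: subset_trans SB _.
  by apply/subsetP => w; rewrite inE => /andP[].
apply: (nofan sz us) es; apply/allP => w /sB.
by rewrite inE => /andP[].
Qed.

(** A stable subset of a clique has at most one vertex, so [fan_free_degree] applies with q = 2. *)
Lemma fan_free_clique (Q : {set T}) :
  {in Q &, forall x y, x != y -> e x y} -> #|Q| <= n.*2.
Proof.
move=> clQ; have [->|[v vQ]] := set_0Vmem Q; first by rewrite cards0.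
have := @fan_free_degree 2 Q v; have := cardsD1 v Q; rewrite vQ => ->.
have -> : [set w in Q | e v w] = Q :\ v.
  apply/setP => w; rewrite !inE; have [->|nwv] := eqVneq w v.
    by rewrite e_irr andbF.
  by case wQ: (w \in Q); rewrite //= clQ // eq_sym.
suff H : forall S : {set T}, S \subset Q -> stable S -> #|S| < 2.
  by move=> /(_ H); lia.
move=> S /subsetP SQ /stableP stS; rewrite ltnS leqNgt; apply/negP.
case/card_gt1P => x [y [xS yS nxy]].
by have := stS x y xS yS; rewrite clQ // SQ.
Qed.

End Independence.

Section Sums.

Variable T : finType.

Lemma sum_mem (B D : {set T}) : \sum_(w in B) (w \in D) = #|B :&: D|.
Proof.
rewrite -sum1_card [RHS](eq_bigl (fun w => (w \in B) && (w \in D))).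
  by rewrite [RHS]big_mkcondr; apply: eq_bigr => w _; case: (w \in D).
by move=> w; rewrite inE.
Qed.

Lemma leq_sum_subset (B D : {set T}) (F : T -> nat) :
  B \subset D -> \sum_(w in B) F w <= \sum_(w in D) F w.
Proof.
by move=> /setIidPr BD; rewrite [leqRHS](big_setID B) /= BD leq_addr.
Qed.

End Sums.

(** * Closed neighbourhoods in a large set without stable (k + 1)-sets *)

Section Transversals.

Variables (T : finType) (e : rel T).
Hypotheses (e_sym : symmetric e) (e_irr : irreflexive e).
Variable n : nat.
Hypothesis nofan : fan_free e n.

Variables (k : nat) (A : {set T}).
Hypothesis k_ge2 : 1 < k.
Hypothesis kn : k * k + k <= n.*2 + 2.
Hypothesis Alarge : k * n.*2 < #|A|.
Hypothesis Astable :
  forall S : {set T}, S \subset A -> stable e S -> #|S| < k.+1.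
(** The induction hypothesis for stable sets of size k - 1. *)
Hypothesis Astable2 : forall B : {set T}, B \subset A ->
  (k - 2) * n.*2 < #|B| ->
  exists S : {set T}, [/\ S \subset B, stable e S & k.-1 <= #|S|].

Definition near (v w : T) : bool := (v == w) || e v w.
Definition nbhd (v : T) : {set T} := [set w in A | near v w].

Lemma near_sym : symmetric near.
Proof. by move=> v w; rewrite /near eq_sym e_sym. Qed.

Lemma near_refl v : near v v.
Proof. by rewrite /near eqxx. Qed.

Lemma nearN v w : ~~ near v w -> ~~ e v w.
Proof. by rewrite negb_or => /andP[]. Qed.

Lemma card_nbhd v : #|nbhd v| < n.*2 + k.
Proof.
have := fan_free_degree e_irr nofan v Astable.
suff : #|nbhd v| <= 1 + #|[set w in A | e v w]| by lia.
apply: leq_trans (_ : #|v |: [set w in A | e v w]| <= _); last first.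
  by rewrite cardsU1; case: (_ \notin _).
apply: subset_leq_card; apply/subsetP => w; rewrite !inE /near eq_sym.
by case: (w == v).
Qed.

Lemma card_common_nbhd a b : a \in A -> b \in A -> ~~ near a b ->
  #|nbhd a :&: nbhd b| + 3 <= k.*2.
Proof.
move=> aA bA nab; rewrite leqNgt; apply/negP => codeg.
pose B := A :\: (nbhd a :|: nbhd b).
have := cardsUI (nbhd a) (nbhd b); have := card_nbhd a; have := card_nbhd b.
have := cardsID (nbhd a :|: nbhd b) A; rewrite -/B.
have -> : A :&: (nbhd a :|: nbhd b) = nbhd a :|: nbhd b.
  by apply/setIidPr; apply/subsetP => w; rewrite !inE; case: (w \in A).
move=> cB cb ca cab.
(* With 2k - 2 common neighbours the union has at most 2(2n + k - 1) - (2k - 2) = 4n vertices, so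
   more than (k - 2)2n vertices remain in [B]. *)
have [|S [/subsetP SB stS cS]] := @Astable2 B (subsetDl _ _).
  have : 2 * n.*2 <= k * n.*2 by rewrite leq_mul2r k_ge2 orbT.
  by have := Alarge; rewrite mulnBl; lia.
have SP w : w \in S -> [/\ w \in A, ~~ near a w & ~~ near b w].
  by move=> /SB; rewrite !inE negb_or; case: (w \in A); rewrite ?andbF //= andbT => /andP[].
have aS : a \notin S by apply/negP => /SP[_]; rewrite near_refl.
have bS : b \notin S by apply/negP => /SP[_ _]; rewrite near_refl.
have := @Astable (a |: (b |: S)).
rewrite !cardsU1 !inE (negPf aS) bS orbF.
have -> : a != b by apply: contraNneq nab => ->; rewrite near_refl.
suff H : (a |: (b |: S)) \subset A /\ stable e (a |: (b |: S)).
  by case: H => H1 H2 /(_ H1 H2); lia.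
split.
  by apply/subsetP => w; rewrite !inE => /or3P[/eqP->|/eqP->|/SP[]].
apply: stable_setU1 => //.
  by apply: stable_setU1 => // w /SP[_ _ /nearN].
by move=> w; rewrite !inE => /orP[/eqP->|/SP[_ /nearN]] //; apply: nearN.
Qed.

(** * Coverage by stable k-sets *)

Definition indep (y : 'I_k -> T) : Prop :=
  (forall i, y i \in A) /\ forall i j, i != j -> ~~ near (y i) (y j).

Definition cov (y : 'I_k -> T) (w : T) : nat := \sum_i near (y i) w.

Lemma indep_inj y : indep y -> injective y.
Proof.
case=> _ sty i j yij; apply/eqP; apply: contraT => /sty.
by rewrite yij near_refl.
Qed.

(** A vertex near no [y i] would extend the family to a stable set of size k + 1. *)
Lemma cov_gt0 y w : indep y -> w \in A -> 0 < cov y w.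
Proof.
move=> iy wA; rewrite lt0n sum_nat_eq0; apply/negP => /forallP nyw.
have nw i : ~~ near (y i) w by have := nyw i; rewrite /=; case: near.
have [yA sty] := iy.
have := @Astable (w |: [set y i | i : 'I_k]).
rewrite cardsU1 card_imset ?card_ord; last exact: indep_inj.
have -> : w \notin [set y i | i : 'I_k].
  by apply/imsetP => -[i _ wi]; have := nw i; rewrite wi near_refl.
rewrite add1n ltnn => H; apply: notF; apply: H.
  by apply/subsetP => z /setU1P[->//|/imsetP[i _ ->]].
apply: stable_setU1 => //.
  apply/stableP => _ _ /imsetP[i _ ->] /imsetP[j _ ->].
  by have [->|/sty/nearN//] := eqVneq i j; rewrite e_irr.
by move=> _ /imsetP[i _ ->]; rewrite e_sym; apply: nearN.
Qed.

(** Double counting: the closed neighbourhoods have total size at most k(2n + k - 1), while [A] has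
    more than 2kn vertices, each covered at least once. *)
Lemma cov_excess y : indep y -> \sum_(w in A) (cov y w).-1 < k * k - k.
Proof.
move=> iy.
have cA : \sum_(w in A) (cov y w).-1 + #|A| = \sum_i #|nbhd (y i)|.
  rewrite -sum1_card -big_split /=.
  transitivity (\sum_(w in A) cov y w).
    by apply: eq_bigr => w wA; rewrite addn1 prednK // cov_gt0.
  rewrite /cov exchange_big /=; apply: eq_bigr => i _.
  have -> : nbhd (y i) = A :&: [set w | near (y i) w].
    by apply/setP => w; rewrite !inE.
  by rewrite -sum_mem; apply: eq_bigr => w _; rewrite inE.
have : \sum_i #|nbhd (y i)| <= \sum_(i < k) (n.*2 + k.-1).
  by apply: leq_sum => i _; have := card_nbhd (y i); lia.
rewrite sum_nat_const card_ord -cA mulnDr.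
have -> : k * k.-1 = k * k - k by rewrite -subn1 mulnBr muln1.
by have := Alarge; lia.
Qed.

Lemma cov_ge2 y w i j :
  i != j -> near (y i) w -> near (y j) w -> 1 < cov y w.
Proof.
move=> nij ni nj; rewrite /cov (bigD1 i) //= (bigD1 j) /=; last by rewrite eq_sym.
by rewrite ni nj.
Qed.

Lemma cov_ge3 y w i j l : i != j -> i != l -> j != l ->
  near (y i) w -> near (y j) w -> near (y l) w -> 2 < cov y w.
Proof.
move=> nij nil njl ni nj nl.
rewrite /cov (bigD1 i) //= (bigD1 j) /=; last by rewrite eq_sym.
by rewrite (bigD1 l) /= ?ni ?nj ?nl // eq_sym nil eq_sym.
Qed.

(** * Private neighbourhoods *)

Variable u : 'I_k -> T.
Hypothesis iu : indep u.

Definition priv (i : 'I_k) : {set T} :=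
  [set w in A | near (u i) w & [forall j, (j != i) ==> ~~ near (u j) w]].

Lemma privP i w : reflect
  [/\ w \in A, near (u i) w & forall j, j != i -> ~~ near (u j) w]
  (w \in priv i).
Proof.
rewrite inE; apply: (iffP and3P) => -[wA ni H]; split=> //.
  by move=> j; apply/implyP/(forallP H).
by apply/forallP => j; apply/implyP; apply: H.
Qed.

Lemma priv_subset i : priv i \subset A.
Proof. by apply/subsetP => w /privP[]. Qed.

Lemma mem_priv i : u i \in priv i.
Proof. by apply/privP; rewrite near_refl; case: iu => uA H; split=> // j; apply: H. Qed.

(** Two vertices of [priv i] not near each other could replace [u i] and give a stable set of size k
    + 1. *)
Lemma priv_clique i : {in priv i &, forall a b, near a b}.
Proof.
move=> a b /privP[aA ua Ha] /privP[bA ub Hb]; apply: contraT => nab.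
have [uA stu] := iu.
pose J := [set u j | j in [set~ i]].
have cJ : #|J| = k.-1.
  by rewrite card_imset ?cardsC1 ?card_ord //; apply: indep_inj.
have aJ : a \notin J.
  apply/imsetP => -[j]; rewrite !inE => ji aj.
  by have := Ha j ji; rewrite aj near_refl.
have bJ : b \notin J.
  apply/imsetP => -[j]; rewrite !inE => ji bj.
  by have := Hb j ji; rewrite bj near_refl.
have := @Astable (a |: (b |: J)); rewrite !cardsU1 !inE (negPf aJ) bJ orbF cJ.
have -> : a != b by apply: contraNneq nab => ->; rewrite near_refl.
suff H : (a |: (b |: J)) \subset A /\ stable e (a |: (b |: J)).
  by case: H => H1 H2 /(_ H1 H2); lia.
split.
  by apply/subsetP => w; rewrite !inE => /or3P[/eqP->|/eqP->|/imsetP[j _ ->]].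
have nJ z : (forall j, j != i -> ~~ near (u j) z) -> {in J, forall w, ~~ e z w}.
  by move=> Hz _ /imsetP[j ji ->]; rewrite e_sym; apply/nearN/Hz; rewrite !inE in ji.
apply: stable_setU1 => //.
  apply: stable_setU1 => //; last exact: nJ.
  apply/stableP => _ _ /imsetP[j _ ->] /imsetP[l _ ->].
  by have [->|/stu/nearN//] := eqVneq j l; rewrite e_irr.
by move=> w /setU1P[->|]; [apply: nearN | apply: nJ].
Qed.

Lemma priv_disjoint i j w : i != j -> w \in priv i -> w \in priv j -> False.
Proof.
by move=> nij /privP[_ ui _] /privP[_ _ /(_ i nij)]; rewrite ui.
Qed.

Lemma near_clique_card (Q : {set T}) :
  {in Q &, forall a b, near a b} -> #|Q| <= n.*2.
Proof.
move=> H; apply: (fan_free_clique e_irr nofan) => a b aQ bQ nab.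
by have := H a b aQ bQ; rewrite /near (negPf nab).
Qed.

(* The vertices in no private neighbourhood are multiply covered, and each
   private neighbourhood outside B accounts for at most 2n vertices. *)
Lemma card_priv_sum (B : {set 'I_k}) :
  #|B| * n.*2 + 2 <= \sum_(i in B) #|priv i| + (k * k - k).
Proof.
have := cov_excess iu.
have cA : #|A| <= \sum_i #|priv i| + \sum_(w in A) (cov u w).-1.
  have -> : \sum_i #|priv i| = \sum_(w in A) \sum_i (w \in priv i).
    rewrite exchange_big /=; apply: eq_bigr => i _.
    by rewrite sum_mem (setIidPr (priv_subset i)).
  rewrite -sum1_card -big_split /=; apply: leq_sum => w wA.
  have : 0 < cov u w by apply: cov_gt0.
  rewrite lt0n sum_nat_eq0 => /forallPn[i]; rewrite /= eqb0 negbK => ui.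
  have [/existsP[j /andP[ji uj]]|/existsPn nj] :=
    boolP [exists j, (j != i) && near (u j) w].
    by have := cov_ge2 ji uj ui; lia.
  rewrite (bigD1 i) //= (_ : w \in priv i) //.
  by apply/privP; split=> // j ji; have := nj j; rewrite ji.
have : \sum_i #|priv i| <= \sum_(i in B) #|priv i| + #|~: B| * n.*2.
  rewrite (bigID (mem B)) /= leq_add2l -sum_nat_const.
  rewrite [leqRHS](eq_bigl (fun i => i \notin B)); last by move=> i; rewrite inE.
  by apply: leq_sum => i _; apply/near_clique_card/priv_clique.
have := cardsC B; rewrite card_ord => cB.
by move: Alarge; rewrite -[X in X * _ < _]cB mulnDl; lia.
Qed.

Lemma leq_sqk : k <= k * k.
Proof. by rewrite leq_pmulr // ltnW. Qed.

Lemma leq_sqk_quad : 7 * k <= k * k + 13.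
Proof. by have [] := leqP k 3; nia. Qed.

(** The lower bound on n enters here: 2n + 2 - (k^2 - k) >= 2k by [kn]. *)
Lemma card_priv1 i : k.*2 <= #|priv i|.
Proof. by have := leq_sqk; have := card_priv_sum [set i]; rewrite big_set1 cards1; lia. Qed.

Lemma card_priv2 i j : i != j ->
  n.*2.*2 + 2 <= #|priv i| + #|priv j| + (k * k - k).
Proof.
by move=> nij; have := card_priv_sum [set i; j]; rewrite big_setU1 ?inE //= big_set1 cards2 nij; lia.
Qed.

Lemma card_priv3 i j l : i != j -> i != l -> j != l ->
  3 * n.*2 + 2 <= #|priv i| + #|priv j| + #|priv l| + (k * k - k).
Proof.
move=> nij nil njl; have := card_priv_sum [set i; j; l].
rewrite -setUA big_setU1 ?inE ?negb_or ?nij //= big_setU1 ?inE //= big_set1.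
by rewrite !cardsU1 cards1 !inE negb_or nij nil njl; lia.
Qed.

(** As [priv i] is a clique containing [b], its vertices near [w] are near both [b] and [w], and
    [card_common_nbhd] applies. *)
Lemma near_priv_small i w b : w \in A -> b \in priv i -> ~~ near b w ->
  #|priv i :&: nbhd w| + 3 <= k.*2.
Proof.
move=> wA bi nbw; have bA := subsetP (priv_subset i) b bi.
apply: leq_trans (card_common_nbhd bA wA nbw); rewrite leq_add2r.
apply/subset_leq_card/setSI/subsetP => z zi; rewrite inE (priv_clique bi zi) andbT.
exact: subsetP (priv_subset i) z zi.
Qed.

Lemma near_other_priv_small i j w : i != j -> w \in priv j ->
  #|priv i :&: nbhd w| + 3 <= k.*2.
Proof.
move=> nij /privP[wA _ /(_ i nij)]; apply: near_priv_small => //.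
exact: mem_priv.
Qed.

(** The vertices near all of [priv i] form a clique, since two that are not near each other would
    share its 2k or more vertices. So each [Q i] has at most 2n vertices, and together they miss
    some [x] in [A]. *)
Lemma exists_unabsorbed :
  exists2 x, x \in A & forall i, #|priv i :&: nbhd x| + 3 <= k.*2.
Proof.
pose Q i := [set w in A | [forall b in priv i, near b w]].
have cQ i : #|Q i| <= n.*2.
  apply: near_clique_card => a b; rewrite !inE => /andP[aA /forall_inP Ha].
  move=> /andP[bA /forall_inP Hb]; apply: contraT => nab.
  have := card_common_nbhd aA bA nab; have := card_priv1 i.
  suff : #|priv i| <= #|nbhd a :&: nbhd b| by lia.
  apply/subset_leq_card/subsetP => z zi; rewrite !inE.
  by rewrite (subsetP (priv_subset i) z zi) near_sym Ha //= near_sym Hb.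
have [/exists_inP[x xA /forallP xQ]|/exists_inPn AQ] :=
  boolP [exists x in A, [forall i, x \notin Q i]].
  exists x => // i; have := xQ i; rewrite !inE xA /= => /forall_inPn[b bi nbx].
  exact: near_priv_small bi nbx.
have := Alarge; rewrite ltnNge => /negP[].
rewrite -[X in X * _]card_ord -sum_nat_const -sum1_card.
apply: (@leq_trans (\sum_(x in A) \sum_i (x \in Q i))).
  apply: leq_sum => x /AQ /forallPn[i]; rewrite negbK => xi.
  by rewrite (bigD1 i) //= xi.
rewrite exchange_big /=; apply: leq_sum => i _; rewrite sum_mem.
by apply: leq_trans (cQ i); rewrite subset_leq_card // subsetIr.
Qed.

(** * Transversals of the private neighbourhoods and exchanges *)

Definition transversal (y : 'I_k -> T) : Prop :=
  (forall i, y i \in priv i) /\ forall i j, i != j -> ~~ near (y i) (y j).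

(** The admissible replacements for [y i] when the other entries are kept. *)
Definition free (y : 'I_k -> T) (i : 'I_k) : {set T} :=
  [set w in priv i | [forall j, (j != i) ==> ~~ near (y j) w]].

Definition upd (y : 'I_k -> T) (i : 'I_k) (b : T) : 'I_k -> T :=
  fun j => if j == i then b else y j.

Lemma freeP y i w : reflect
  (w \in priv i /\ forall j, j != i -> ~~ near (y j) w) (w \in free y i).
Proof.
rewrite [w \in free y i]inE; apply: (iffP andP) => -[wi H]; split=> //.
  by move=> j; apply/implyP/(forallP H).
by apply/forallP => j; apply/implyP; apply: H.
Qed.

Lemma transversal_indep y : transversal y -> indep y.
Proof.
by case=> yP sty; split=> // i; apply: (subsetP (priv_subset i)).
Qed.

Lemma transversal_upd y i b :
  transversal y -> b \in free y i -> transversal (upd y i b).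
Proof.
move=> [yP sty] /freeP[bi Hb]; split=> [j|j l jl]; rewrite /upd.
  by have [->|] := eqVneq j i.
have [ji|ji] := eqVneq j i; have [li|li] := eqVneq l i.
- by rewrite ji li eqxx in jl.
- by rewrite near_sym Hb.
- exact: Hb.
- exact: sty.
Qed.

Lemma transversal_u : transversal u.
Proof. by split; [apply: mem_priv | case: iu]. Qed.

(** A vertex of [priv i] that is not free is near [y i], by the clique property, and near another
    entry, so its excess is at least 1. *)
Lemma card_free y i : transversal y ->
  #|priv i| <= #|free y i| + \sum_(w in priv i) (cov y w).-1.
Proof.
move=> [yP sty]; rewrite -sum1_card.
have -> : #|free y i| = \sum_(w in priv i) (w \in free y i).
  by rewrite sum_mem; congr #|pred_of_set _|; apply/esym/setIidPr/subsetP => w /freeP[].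
rewrite -big_split /=; apply: leq_sum => w wi.
have [//|wf] := boolP (w \in free y i).
have /existsP[j /andP[ji yj]] : [exists j, (j != i) && near (y j) w].
  apply: contraNT wf => /existsPn nj; apply/freeP; split=> // j ji.
  by have := nj j; rewrite ji.
by have := cov_ge2 ji yj (priv_clique (yP i) wi); lia.
Qed.

Lemma excess_two_parts y i j : transversal y -> i != j ->
  \sum_(w in priv i) (cov y w).-1 + \sum_(w in priv j) (cov y w).-1 < k * k - k.
Proof.
move=> ty nij; apply: leq_ltn_trans (cov_excess (transversal_indep ty)).
rewrite [leqRHS](big_setID (priv i)) /= (setIidPr (priv_subset i)) leq_add2l.
apply: leq_sum_subset; apply/subsetP => w wj; rewrite inE (subsetP (priv_subset j)) // andbT.
by apply/negP => wi; apply: priv_disjoint nij wi wj.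
Qed.

(** * Descent on the number of entries near [x] *)

Section Descent.

Variable x : T.
Hypothesis xA : x \in A.
Hypothesis x_small : forall i, #|priv i :&: nbhd x| + 3 <= k.*2.

Variables a b : 'I_k.
Hypothesis nab : a != b.
Hypothesis a_min : forall i, #|priv a| <= #|priv i|.
Hypothesis b_min : forall i, i != a -> #|priv b| <= #|priv i|.

(** As [priv a] is no larger than either, at least two thirds of the bound in [card_priv3] falls on
    i and j. The value k^2 + 5k - 9 is one above what [doubly_covered] and [hit_absurd] leave
    possible. *)
Lemma priv_pair_large i j : i != a -> j != a -> i != j ->
  k * k + 5 * k <= #|priv i| + #|priv j| + 9.
Proof.
move=> ia ja nij; have := card_priv3 nij ia ja.
have := a_min i; have := a_min j; have := leq_sqk_quad; have := leq_sqk.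
have := kn; clear; move: (k * k) #|priv i| #|priv j| #|priv a|.
by lia.
Qed.

Definition hits (y : 'I_k -> T) : nat := #|[set i | near (y i) x]|.

(** Keeping [y a] and [y b] away from [x] ensures that an entry j near [x] differs from a and b;
    then [priv j] is at least as large as [priv b] and [priv_pair_large] applies. *)
Definition good (y : 'I_k -> T) : Prop :=
  [/\ transversal y, ~~ near (y a) x & ~~ near (y b) x].

Lemma exists_good : exists y, good y.
Proof.
have [E|[ya /setDP[yaP nyx]]] := set_0Vmem (priv a :\: nbhd x).
  have := cardsID (nbhd x) (priv a); rewrite E cards0.
  by have := x_small a; have := card_priv1 a; lia.
have nxa : ~~ near ya x.
  by rewrite inE (subsetP (priv_subset a)) //= near_sym in nyx.
have ty : transversal (upd u a ya).
  apply: transversal_upd transversal_u _; apply/freeP; split=> //.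
  by case/privP: yaP.
(* [ya] and [x] exclude at most 4k - 6 vertices of [priv b], while [card_priv2] and [a_min] give
   2|P_b| >= k^2 + 3k - 2 > 2(4k - 6). *)
have [E|[yb /setDP[/setDP[ybP yba] ybx]]] :=
  set_0Vmem ((priv b :\: nbhd ya) :\: nbhd x).
  have := cardsID (nbhd ya) (priv b).
  have := cardsID (nbhd x) (priv b :\: nbhd ya); rewrite E cards0.
  have : #|(priv b :\: nbhd ya) :&: nbhd x| <= #|priv b :&: nbhd x|.
    exact/subset_leq_card/setSI/subsetDl.
  have nba : b != a by rewrite eq_sym.
  have := near_other_priv_small nba yaP; have := x_small b.
  have := card_priv2 nab; have := a_min b; have := leq_sqk; have := kn.
  by nia.
have ybA := subsetP (priv_subset b) yb ybP.
exists (upd (upd u a ya) b yb); split.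
- apply: transversal_upd ty _; apply/freeP; split=> // j jb; rewrite /upd.
  have [_|ja] := eqVneq j a; first by rewrite inE ybA in yba.
  by case/privP: ybP => _ _; apply.
- by rewrite /upd (negPf nab) eqxx.
- by rewrite /upd eqxx near_sym; rewrite inE ybA in ybx.
Qed.

Lemma hits_lt y y' j : near (y j) x -> ~~ near (y' j) x ->
  (forall i, near (y' i) x -> near (y i) x) -> hits y' < hits y.
Proof.
move=> yj y'j H; apply/proper_card/properP; split.
  by apply/subsetP => i; rewrite !inE; apply: H.
by exists j; rewrite inE.
Qed.

Section Minimal.

Variable y : 'I_k -> T.
Hypothesis gy : good y.
Hypothesis y_min : forall y', good y' -> hits y <= hits y'.
Variable j : 'I_k.
Hypothesis yjx : near (y j) x.

Let ty : transversal y. Proof. by case: gy. Qed.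

Let nja : j != a.
Proof. by case: gy => _ yax _; apply: contraNneq yax => <-. Qed.

Let njb : j != b.
Proof. by case: gy => _ _ ybx; apply: contraNneq ybx => <-. Qed.

(* Otherwise exchanging y_j for a vertex of [free y j] would lower [hits]. *)
Lemma free_near : free y j \subset priv j :&: nbhd x.
Proof.
apply/subsetP => w wf; have /freeP[wj Hw] := wf.
have wA := subsetP (priv_subset j) w wj.
rewrite in_setI wj inE wA /=; apply: contraT => nxw.
have [_ yax ybx] := gy.
suff : hits (upd y j w) < hits y.
  rewrite ltnNge y_min //; split.
  - exact: transversal_upd.
  - by rewrite /upd eq_sym (negPf nja).
  - by rewrite /upd eq_sym (negPf njb).
apply: (hits_lt yjx); first by rewrite /upd eqxx near_sym.
by move=> i; rewrite /upd; have [->|//] := eqVneq i j.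
Qed.

(* If w is covered only by y_i and y_j, then exchanging y_j for w and y_i for a
   vertex of [free y i] far from x and w would lower [hits]; so all of [free y i]
   is near x or w, which the size of the classes i and j forbids. *)
Lemma doubly_covered i w : i != j -> i != a -> w \in priv j ->
  ~~ near x w -> near (y i) w ->
  exists l, [/\ l != i, l != j & near (y l) w].
Proof.
move=> nij nia wj nxw yiw.
have [/existsP[l /and3P[li lj ylw]]|/existsPn nl] :=
  boolP [exists l, [&& l != i, l != j & near (y l) w]].
  by exists l.
have wA := subsetP (priv_subset j) w wj.
have nlw l : l != i -> l != j -> ~~ near (y l) w.
  by move=> li lj; have := nl l; rewrite li lj.
have [_ yax ybx] := gy.
have sub : free y i \subset (priv i :&: nbhd x) :|: (priv i :&: nbhd w).
  apply/subsetP => c cf; have /freeP[ci Hc] := cf.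
  have cA := subsetP (priv_subset i) c ci.
  rewrite -setIUr in_setI ci !inE cA /=; apply: contraT.
  rewrite negb_or => /andP[nxc nwc].
  have tc := transversal_upd ty cf.
  suff : hits (upd (upd y i c) j w) < hits y.
    rewrite ltnNge y_min //; split.
    - apply: transversal_upd => //; apply/freeP; split=> // l lj; rewrite /upd.
      by have [_|li] := eqVneq l i; [rewrite near_sym | apply: nlw].
    - by rewrite /upd eq_sym (negPf nja) eq_sym (negPf nia).
    - rewrite /upd eq_sym (negPf njb); have [_|//] := eqVneq b i.
      by rewrite near_sym.
  apply: (hits_lt yjx); first by rewrite /upd eqxx near_sym.
  move=> l; rewrite /upd; have [->|_] := eqVneq l j; first by [].
  by have [->|//] := eqVneq l i; rewrite near_sym (negPf nxc).
have := excess_two_parts ty nij; have := priv_pair_large nia nja nij.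
have := card_free i ty; have := card_free j ty.
have : #|free y i| + 6 <= k.*2 + k.*2.
  have := cardsUI (priv i :&: nbhd x) (priv i :&: nbhd w).
  have := subset_leq_card sub; have := x_small i.
  by have := near_other_priv_small nij wj; clear; lia.
have : #|free y j| + 3 <= k.*2.
  by have := subset_leq_card free_near; have := x_small j; clear; lia.
move: (\sum_(_ in priv i) _) (\sum_(_ in priv j) _) => ei ej.
have := leq_sqk; clear; move: (k * k) #|priv i| #|priv j| #|free y i| #|free y j|.
by lia.
Qed.

(** Each vertex of [priv j] not near [x] has excess at least 2, or excess at least 1 and is near
    [y a]. Summing, 2|P_j| <= 3(2k - 3) + (k^2 - k - 1) = k^2 + 5k - 10, whereas |P_j| >= |P_b| and
    [priv_pair_large] force one more. *)
Lemma hit_absurd : False.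
Proof.
have [_ yax ybx] := gy; have [yP sty] := ty.
have cov_count w : w \in priv j ->
  2 <= (w \in nbhd x) * 2 + ((cov y w).-1 + (w \in nbhd (y a))).
  move=> wj; have wA := subsetP (priv_subset j) w wj.
  have [//|wx] := boolP (w \in nbhd x).
  have nxw : ~~ near x w by rewrite inE wA in wx.
  have yjw : near (y j) w := priv_clique (yP j) wj.
  have /existsP[i /andP[nij yiw]] : [exists i, (i != j) && near (y i) w].
    apply: contraNT wx => /existsPn H.
    have /(subsetP free_near) : w \in free y j.
      by apply/freeP; split=> // i ij; have := H i; rewrite ij.
    by case/setIP.
  (* The smallest class a is outside the scope of [doubly_covered]; such [w] are charged to the at
     most 2k - 3 vertices of [priv j] near [y a]. *)
  have [ia|nia] := eqVneq i a.
    have -> : w \in nbhd (y a) by rewrite inE wA -ia.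
    by case: (cov y w) (cov_ge2 nij yiw yjw) => [|[|c]] // _; rewrite addn1.
  have [l [nli nlj ylw]] := doubly_covered nij nia wj nxw yiw.
  case: (cov y w) (cov_ge3 nli nlj nij ylw yiw yjw) => [|[|[|c]]] // _.
have : \sum_(w in priv j) 2 <= \sum_(w in priv j)
    ((w \in nbhd x) * 2 + ((cov y w).-1 + (w \in nbhd (y a)))).
  exact: leq_sum.
rewrite !big_split /= -big_distrl /= !sum_mem sum_nat_const.
have nba : b != a by rewrite eq_sym.
have nbj : b != j by rewrite eq_sym.
have := x_small j; have := near_other_priv_small nja (yP a).
have := excess_two_parts ty nja; have := priv_pair_large nba nja nbj.
have := b_min nja.
move: (\sum_(_ in priv j) _) (\sum_(_ in priv a) _) => ej ea.
have := leq_sqk; clear; move: (k * k) #|priv j| #|priv b|.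
move: #|priv j :&: nbhd x| #|priv j :&: nbhd (y a)|.
by lia.
Qed.

End Minimal.

Lemma no_good y : ~ good y.
Proof.
have [m] := ubnP (hits y); elim: m y => // m IHm y ltm gy.
have ymin y' : good y' -> hits y <= hits y'.
  by move=> gy'; rewrite leqNgt; apply/negP => lt; apply: IHm gy'; lia.
(* The entries of [y] dominate [A], so some [y j] is near [x]. *)
have := cov_gt0 (transversal_indep (let: And3 t _ _ := gy in t)) xA.
rewrite lt0n sum_nat_eq0 => /forallPn[j]; rewrite /= eqb0 negbK.
exact: hit_absurd.
Qed.

End Descent.

Lemma indep_absurd : False.
Proof.
have [x xA x_small] := exists_unabsorbed.
have k_gt0 : 0 < k by apply: ltnW.
pose i0 : 'I_k := Ordinal k_gt0; pose i1 : 'I_k := Ordinal k_ge2.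
case: (arg_minnP (fun i => #|priv i|) (isT : xpredT i0)) => a _ a_min.
have [i ia] : exists i, i != a.
  by have [<-|] := eqVneq i0 a; [exists i1 | exists i0].
case: (@arg_minnP _ i (fun j => j != a) (fun j => #|priv j|) ia) => b ba b_min.
have nab : a != b by rewrite eq_sym.
have mina l : #|priv a| <= #|priv l| by apply: a_min.
have [y gy] := exists_good xA x_small nab mina.
exact: (@no_good x xA x_small a b nab mina b_min y gy).
Qed.

End Transversals.

(** * Induction on the size of the stable set *)

Lemma fan_free_stable (T : finType) (e : rel T) n :
  symmetric e -> irreflexive e -> fan_free e n ->
  forall q (A : {set T}), q * q <= n.*2 + q + 2 -> q.-1 * n.*2 < #|A| ->
  exists S : {set T}, [/\ S \subset A, stable e S & q <= #|S|].
Proof.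
(* The induction is used at q - 1, for the stable set [u], and at q - 2, for [Astable2]. *)
move=> e_sym e_irr nofan; elim/ltn_ind => q IH A qn Alarge.
have [/existsP[S /and3P[? ? ?]]|/existsPn noS] :=
  boolP [exists S : {set T}, [&& S \subset A, stable e S & q <= #|S|]].
  by exists S.
have Astable (S : {set T}) : S \subset A -> stable e S -> #|S| < q.
  by move=> SA stS; have := noS S; rewrite SA stS /= -ltnNge.
(* q = 2 is the clique bound; from q = 3 on the transversal argument runs with k = q - 1. *)
case: q => [|[|[|k]]] in IH qn Alarge Astable {noS} *.
- by exists set0; rewrite sub0set stable_set0.
- have [E|[x xA]] := set_0Vmem A; first by rewrite E cards0 in Alarge.
  by exists [set x]; rewrite sub1set xA stable_set1 // cards1.
- exfalso; rewrite mul1n ltnNge in Alarge; case/negP: Alarge.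
  apply: (fan_free_clique e_irr nofan) => x y xA yA nxy; apply: contraT => nexy.
  have : #|[set x; y]| < 2.
    apply: Astable; first by apply/subsetP => z; rewrite !inE => /orP[]/eqP->.
    apply: stable_setU1 => //; first exact: stable_set1.
    by move=> z /set1P->.
  by rewrite cards2 nxy.
exfalso; rewrite /= in Alarge.
have kn : k.+2 * k.+2 + k.+2 <= n.*2 + 2 by nia.
have Astable2 (B : {set T}) : B \subset A -> (k.+2 - 2) * n.*2 < #|B| ->
    exists S : {set T}, [/\ S \subset B, stable e S & k.+2.-1 <= #|S|].
  by move=> _ Bl; apply: IH => //; [nia | rewrite subn2 in Bl].
have [||S [SA stS cS]] := IH k.+2 (ltnSn _) A.
- by nia.
- by apply: leq_ltn_trans Alarge; rewrite leq_mul2r leqnSn orbT.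
have cS' : #|S| = k.+2.
  by apply/eqP; rewrite eqn_leq cS andbT -ltnS; apply: Astable.
pose u (i : 'I_k.+2) : T := enum_val (cast_ord (esym cS') i).
have uS i : u i \in S by apply: enum_valP.
apply: (indep_absurd e_sym e_irr nofan _ kn Alarge Astable Astable2 (u := u)) => //.
split=> [i|i j nij]; first exact: (subsetP SA).
rewrite negb_or (stableP _ _ stS) // andbT.
by apply: contra nij => /eqP/enum_val_inj/cast_ord_inj->.
Qed.

(** * The upper bound *)

Lemma contains_complete (G : sgraph) p (S : {set G}) :
  p <= #|S| -> stable (@compl_adj G) S -> contains G (complete p).
Proof.
move=> pS /stableP stS.
exists (fun i : complete p => enum_val (widen_ord pS i)).
  by move=> i j /enum_val_inj/(congr1 val) /= /val_inj.
move=> i j nij; have := stS _ _ (enum_valP (widen_ord pS i)) (enum_valP (widen_ord pS j)).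
rewrite /compl_adj negb_and !negbK => /orP[/eqP/enum_val_inj/(congr1 val) /= /val_inj ij|//].
by move: nij; rewrite /= /complete_adj ij eqxx.
Qed.

Lemma contains_fan (H : sgraph) n (v : H) (s : seq H) :
  size s = n.*2 -> uniq s -> all (adj v) s ->
  (forall i, i < n -> adj (nth v s i.*2) (nth v s i.*2.+1)) ->
  contains H (fan n).
Proof.
move=> sz us /allP vs es.
have lt (i : 'I_n) (c : bool) : i.*2 + c < size s.
  by rewrite sz; case: i c => i lti [] /=; lia.
have vadj (i : 'I_n) (c : bool) : adj v (nth v s (i.*2 + c)).
  by apply/vs/mem_nth/lt.
exists (fun z : fan n => if z is Some (i, c) then nth v s (i.*2 + c) else v).
  move=> [[i c]|] [[j d]|] //= E.
  - move/eqP: E; rewrite nth_uniq ?lt // => /eqP E.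
    have ij : (i : nat) = j by case: c d E => [] [] /=; lia.
    have -> : i = j by apply: val_inj.
    by congr (Some (_, _)); move: E; rewrite ij => /addnI; case: c d => [] [].
  - by have := vadj i c; rewrite E adj_irrefl.
  - by have := vadj j d; rewrite -E adj_irrefl.
move=> [[i c]|] [[j d]|] //=; last by rewrite adj_sym.
move=> /andP[/eqP<-]; have := es i (ltn_ord i).
by case: c d => [] [] //=; rewrite addn0 addn1 // adj_sym.
Qed.

Lemma arrows_complete_fan p n N : p * p <= n.*2 + p + 2 ->
  p.-1 * n.*2 < N -> arrows N (complete p) (fan n).
Proof.
move=> pn ltN G cG.
have [/existsP[S /andP[pS stS]]|/existsPn noS] :=
  boolP [exists S : {set G}, (p <= #|S|) && stable (@compl_adj G) S].
  by left; apply: contains_complete pS stS.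
right.
have := @fan_free_stable _ (@compl_adj G) n (@compl_adj_sym G) (@compl_adj_irrefl G).
(* Tuples over a finite type are finite in number, so the existence of a fan is decidable. *)
have [/existsP[v /existsP[s /and4P[/eqP ss us vs /forallP es]]] _|/existsPn nofan] :=
  boolP [exists v : G, [exists s : n.*2.-tuple G, [&& size s == n.*2, uniq s,
    all (@compl_adj G v) s &
    [forall i : 'I_n, compl_adj (nth v s i.*2) (nth v s i.*2.+1)]]]].
  apply: (@contains_fan (compl G) n v s) => // i lti.
  exact: es (Ordinal lti).
case/(_ _ p [set: G]) => [v s ss us vs es||| S [_ stS pS]] //.
- have/existsPn/(_ (Tuple (introT eqP ss))) := nofan v.
  rewrite /= ss eqxx us vs /= => /negP[]; apply/forallP => i; exact: es.
- by rewrite cardsT cG.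
- by have := noS S; rewrite pS stS.
Qed.

(** * The lower bound *)

Lemma multipartite_sym M m :
  symmetric (fun i j : 'I_M => i %/ m != j %/ m).
Proof. by move=> i j; rewrite eq_sym. Qed.

Lemma multipartite_irrefl M m :
  irreflexive (fun i j : 'I_M => i %/ m != j %/ m).
Proof. by move=> i; rewrite eqxx. Qed.

(** The parts are blocks of m consecutive integers, the last one possibly shorter, so that every
    order M is available. *)
Definition multipartite M m : sgraph :=
  SGraph (@multipartite_sym M m) (@multipartite_irrefl M m).

(** The vertices of a clique lie in distinct parts, of which there are at most r. *)
Lemma multipartite_clique M m r : M <= r * m ->
  ~ contains (multipartite M m) (complete r.+1).
Proof.
move=> Mr [f _ fadj].
have lt (i : 'I_r.+1) : f i %/ m < r.
  rewrite ltn_divLR; first exact: leq_trans (ltn_ord _) Mr.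
  have := leq_trans (ltn_ord (f i)) Mr; rewrite lt0n.
  by apply: contraTneq => ->; rewrite muln0.
have := leq_card (fun i => Ordinal (lt i)); rewrite !card_ord ltnn => H.
suff /H : injective (fun i => Ordinal (lt i)) by [].
move=> i j /(congr1 val) /= E; apply/eqP; apply: contraT => nij.
by have := fadj i j nij; rewrite /= E eqxx.
Qed.

(** The centre forces the whole fan into one part, where residues modulo 2n would separate its 2n +
    1 vertices. *)
Lemma multipartite_fan M n : 0 < n ->
  ~ contains (compl (multipartite M n.*2)) (fan n).
Proof.
move=> n_gt0 [f f_inj fadj].
have n2 : 0 < n.*2 by rewrite double_gt0.
have fq z : f z %/ n.*2 = f None %/ n.*2.
  case: z => [[i c]|//]; have := fadj None (Some (i, c)) isT.
  by rewrite /= /compl_adj /= negbK => /andP[_ /eqP].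
have := leq_card (fun z => Ordinal (ltn_pmod (f z) n2)).
rewrite card_option card_prod card_bool !card_ord muln2 ltnn => H.
suff /H : injective (fun z => Ordinal (ltn_pmod (f z) n2)) by [].
move=> y z /(congr1 val) /= E; apply/f_inj/val_inj.
by rewrite /= (divn_eq (f y) n.*2) (divn_eq (f z) n.*2) E !fq.
Qed.

(** * Connectedness of the fan and the exact Ramsey number *)

Lemma fan_connected n : connected (fan n).
Proof.
have c0 (x : fan n) : connect (@adj (fan n)) None x /\ connect (@adj (fan n)) x None.
  by case: x => [x|]; split; rewrite ?connect0 //; apply: connect1; case: x.
split; first by rewrite card_option.
by move=> x y; apply: connect_trans (c0 x).2 (c0 y).1.
Qed.

Lemma ramsey_complete_fan p n : 0 < p -> 0 < n -> p * p <= n.*2 + p + 2 ->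
  is_ramsey_number (complete p) (fan n) (p.-1 * n.*2).+1.
Proof.
move=> p_gt0 n_gt0 pn; split=> // [|M _ arM].
  exact: arrows_complete_fan.
rewrite ltnNge; apply/negP => leM.
case: (arM (multipartite M n.*2) (card_ord M)).
  by rewrite -(prednK p_gt0); apply: multipartite_clique.
exact: multipartite_fan.
Qed.

Theorem theorem4 (p n : nat) (hp : 3 <= p)
    (hn : (p ^ 2 - p - 2) %/ 2 <= n) :
  p_good p (fan n) /\
  is_ramsey_number (complete p) (fan n) (2 * (p - 1) * n + 1).
Proof.
have pn : p * p <= n.*2 + p + 2.
  (* p(p - 1) is even, so the division by 2 in [hn] is exact, with quotient m - 1 for m = p(p -
     1)/2. *)
  have /dvdnP[m Em] : 2 %| p * p.-1.
    by rewrite dvdn2 oddM; case: (p) => //= q; case: (odd q).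
  have Ep : p ^ 2 - p - 2 = (m - 1) * 2.
    by rewrite -mulnn mulnBl -Em -subn1 mulnBr muln1.
  rewrite Ep mulnK // in hn.
  have : p * p = p * p.-1 + p by rewrite addnC -mulnS prednK // ltnW // ltnW.
  by rewrite Em; lia.
have n_gt0 : 0 < n by nia.
have ram := ramsey_complete_fan (ltnW (ltnW hp)) n_gt0 pn.
have -> : 2 * (p - 1) * n + 1 = (p.-1 * n.*2).+1 by rewrite -muln2 subn1; lia.
split=> //; split; first exact: fan_connected.
suff -> : (p - 1) * (#|fan n| - 1) + 1 = (p.-1 * n.*2).+1 by [].
by rewrite card_option card_prod card_bool card_ord muln2 subn1 subn1 addn1.
Qed.
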